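(* Let $G$ be a graph with no isolated vertices and let $1\leq k\leq \nu(G)$. If $I(G)^{[k]}$ has linear quotients with respect to the ordering $u_1,\ldots,u_s$ of its minimal monomial generators, then the following statements are equivalent: (i) $g_{I(G)}(k)=0$. (ii) There exist a dominating $k$-matching $M$ of $G$ and some $i=2,\ldots,s$ which satisfy the following conditions: (a) $V(M)=\operatorname{supp}(u_i)$, and (b) for any $t\in V(G)\setminus V(M)$, there exists a $k$-matching $M'$ of $G$ with $V(M')=\operatorname{supp}(u_j)$ for some $j=1,\ldots,i-1$ such that $V(M')\subseteq V(M)\cup\{t\}$. In particular, if $G$ is a cochordal graph, then statements (i) and (ii) are equivalent.
   Context: Let $K$ be a field, let $G$ be a finite simple graph with vertex set $V(G)=\{1,\ldots,n\}$, and let $S=K[x_1,\ldots,x_n]$. The edge ideal $I(G)\subset S$ is generated by all $x_ix_j$ with $\{i,j\}$ an edge of $G$. A $k$-matching $M$ is a set of $k$ pairwise disjoint edges of $G$; $V(M)$ is the set of vertices contained in edges of $M$; $\nu(G)$ is the maximum size of a matching of $G$. A $k$-matching $M$ is called a dominating $k$-matching if every vertex in $V(G)\setminus V(M)$ is adjacent to some vertex in $V(M)$. The $k$-th squarefree power $I(G)^{[k]}$ is the ideal generated by the squarefree monomials $x_{i_1}x_{j_1}\cdots x_{i_k}x_{j_k}$ where $\{i_1,j_1\},\ldots,\{i_k,j_k\}$ is a $k$-matching of $G$. For $1\le k\le \nu(G)$, the normalized depth function is $g_{I(G)}(k)=\operatorname{depth}(S/I(G)^{[k]})-(2k-1)$.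 For a monomial $u$, $\operatorname{supp}(u)=\{i: x_i\mid u\}$. A monomial ideal has linear quotients with respect to an ordering $u_1,\ldots,u_s$ of its minimal monomial generators if for all $i=2,\ldots,s$ the colon ideal $(u_1,\ldots,u_{i-1}):u_i$ is generated by variables. A graph is cochordal if its complementary graph is chordal, i.e. has no induced cycle of length greater than $3$; for cochordal $G$, the ideal $I(G)^{[k]}$ has linear quotients for every $k=1,\ldots,\nu(G)$, and in the last sentence of the claim $u_1,\ldots,u_s$ is such a linear quotients ordering.
   Formalization: The formal statement assumes s ≥ 2 in both sentences: if s = 1 then n = 2k, so (i) holds but no i = 2,…,s exists and (ii) fails (e.g. G = K_2, k = 1), so the claimed equivalence is false in every case with s = 1. *)

(* Defs.v *)
From HB Require Import structures.
From mathcomp Require Import all_boot all_order all_algebra.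
From mathcomp Require Import mpoly.
From Stdlib Require Import ClassicalEpsilon.

Set Implicit Arguments.
Unset Strict Implicit.
Unset Printing Implicit Defensive.

Import GRing.Theory.

(* The vertex i : 'I_n (numbered from 0) carries the variable 'X_i. *)
Record sgraph (n : nat) := SGraph {
  adj : rel 'I_n;
  adj_sym : ssrbool.symmetric adj;
  adj_irrefl : irreflexive adj
}.

Section Graphs.

Variables (n : nat) (G : sgraph n).

Definition edges : {set {set 'I_n}} :=
  [set [set p.1; p.2] | p : 'I_n * 'I_n & adj G p.1 p.2].

Definition no_isolated : Prop := forall x, exists y, adj G x y.

(* V(M) is [cover M]. *)
Definition matching (M : {set {set 'I_n}}) : bool :=
  (M \subset edges) && trivIset M.

Definition kmatching (k : nat) (M : {set {set 'I_n}}) : bool :=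
  matching M && (#|M| == k).

Definition matching_number : nat := \max_(M | matching M) #|M|.

Definition dominating_kmatching (k : nat) (M : {set {set 'I_n}}) : Prop :=
  kmatching k M /\
  forall v, v \notin cover M -> exists2 w, w \in cover M & adj G v w.

(* The vertices of c, read cyclically, span a cycle with no chord;
   [next c x] is the cyclic successor of x in c. *)
Definition induced_cycle (c : seq 'I_n) : Prop :=
  [/\ 2 < size c, uniq c &
      {in c &, forall x y, adj G x y = (y == next c x) || (x == next c y)}].

Definition chordal : Prop := ~ exists2 c, induced_cycle c & 3 < size c.

Definition compl_adj : rel 'I_n := fun x y => (x != y) && ~~ adj G x y.

Lemma compl_adj_sym : ssrbool.symmetric compl_adj.
Proof. by move=> x y; rewrite /compl_adj eq_sym (adj_sym G). Qed.

Lemma compl_adj_irrefl : irreflexive compl_adj.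
Proof. by move=> x; rewrite /compl_adj eqxx. Qed.

Definition compl_graph : sgraph n := SGraph compl_adj_sym compl_adj_irrefl.

End Graphs.

Definition cochordal n (G : sgraph n) : Prop := chordal (compl_graph G).

Local Open Scope ring_scope.

(* Ideals are represented by their membership predicates. *)
Section Ideals.

Variable R : comNzRingType.

Definition ideal_gen (A : R -> Prop) : R -> Prop := fun f =>
  exists r : seq (R * R),
    (forall p, p \in r -> A p.2) /\ f = \sum_(p <- r) p.1 * p.2.

Definition ideal_add (I J : R -> Prop) : R -> Prop := fun f =>
  exists a b, [/\ I a, J b & f = a + b].

Definition colon (I : R -> Prop) (u : R) : R -> Prop := fun f => I (f * u).

Definition nonzerodivisor_mod (I : R -> Prop) (f : R) : Prop :=
  forall g, I (f * g) -> I g.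

(* fs = f_1, ..., f_r is a regular sequence on R/I: f_i is a nonzerodivisor on
   R/(I + (f_1, ..., f_(i-1))) for all i, and R/(I + (f_1, ..., f_r)) <> 0. *)
Definition regular_seq (I : R -> Prop) (fs : seq R) : Prop :=
  (forall i, (i < size fs)%N ->
     nonzerodivisor_mod
       (ideal_add I (ideal_gen (fun f => f \in take i fs))) fs`_i) /\
  ~ ideal_add I (ideal_gen (fun f => f \in fs)) 1.

End Ideals.

Section PolynomialRing.

Variables (K : fieldType) (n : nat).

Local Notation S := {mpoly K[n]}.

Definition var_ideal (X : {set 'I_n}) : S -> Prop :=
  ideal_gen (fun f => exists2 i, i \in X & f = 'X_i).

Definition graded_max_ideal : S -> Prop := var_ideal [set: 'I_n].

(* d is the maximal length of an S/I-regular sequence contained in the graded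
   maximal ideal. *)
Definition is_depth (I : S -> Prop) (d : nat) : Prop :=
  (exists fs : seq S,
     [/\ size fs = d, forall f, f \in fs -> graded_max_ideal f
       & regular_seq I fs]) /\
  (forall fs : seq S, (forall f, f \in fs -> graded_max_ideal f) ->
     regular_seq I fs -> (size fs <= d)%N).

(* depth(S/I). For I contained in the graded maximal ideal the maximum exists
   (S is Noetherian), so that [epsilon] returns it. *)
Definition depth (I : S -> Prop) : nat :=
  epsilon (inhabits 0%N) (is_depth I).

Definition msupport (u : 'X_{1..n}) : {set 'I_n} := [set i | (0 < u i)%N].

Definition monomial_ideal (us : seq 'X_{1..n}) : S -> Prop :=
  ideal_gen (fun f => exists2 u, u \in us & f = 'X_[u]).

Definition minimal_generators (I : S -> Prop) (us : seq 'X_{1..n}) : Prop :=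
  [/\ uniq us, forall f, I f <-> monomial_ideal us f
    & forall vs : seq 'X_{1..n}, {subset vs <= us} ->
        (forall f, I f <-> monomial_ideal vs f) -> {subset us <= vs}].

(* The monomials u_1, ..., u_s are the entries 0, ..., s - 1 of us. *)
Definition linear_quotients (I : S -> Prop) (us : seq 'X_{1..n}) : Prop :=
  minimal_generators I us /\
  forall i, (0 < i < size us)%N ->
    exists X : {set 'I_n}, forall f,
      colon (monomial_ideal (take i us)) 'X_[nth mnm0 us i] f <->
      var_ideal X f.

Definition sqfree_power (G : sgraph n) (k : nat) : S -> Prop :=
  ideal_gen (fun f => exists2 M, kmatching G k M &
                        f = \prod_(e in M) \prod_(x in e) 'X_x).

Definition normalized_depth (G : sgraph n) (k : nat) : int :=
  (depth (sqfree_power G k))%:Z - (2 * k%:Z - 1).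

End PolynomialRing.

(* With entries numbered from 0, i = 2, ..., s becomes 0 < i < size us. *)
Definition dominating_condition n (G : sgraph n) (k : nat)
    (us : seq 'X_{1..n}) : Prop :=
  exists (M : {set {set 'I_n}}) (i : nat),
    [/\ dominating_kmatching G k M, (0 < i < size us)%N,
        cover M = msupport (nth mnm0 us i)
      & forall t, t \notin cover M ->
          exists (M' : {set {set 'I_n}}) (j : nat),
            [/\ kmatching G k M', (j < i)%N,
                cover M' = msupport (nth mnm0 us j)
              & cover M' \subset t |: cover M]].

(* Main.v *)
Require Import Defs.
From mathcomp Require Import all_boot all_order all_algebra.
From mathcomp Require Import mpoly.
From mathcomp Require Import ring zify.
From Stdlib Require Import ClassicalEpsilon PropExtensionality FunctionalExtensionality.

(** Let u_1, ..., u_s be the generators of I = I(G)^[k], U_i the support of u_i,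
    and X_i the set of variables generating the colon ideal
    (u_1, ..., u_(i-1)) : u_i.  All U_i have d = 2k elements and X_i avoids U_i,
    so #|X_i| <= n - 2k; the proposition rests on the formula
    depth (S/I) = n - 1 - max_i #|X_i|.  It gives depth (S/I) >= 2k - 1, with
    equality iff some X_i is the whole complement of U_i.  Since t is in X_i iff
    some U_j with j < i lies in U_i together with t, that condition on X_i is
    (b) for a matching M covering U_i.  Such an M is then automatically
    dominating: a matching M' with V(M') inside V(M) and t, but V(M') <> V(M),
    has an edge joining t to V(M).

    Only the part of the formula around 2k - 1 is proved, by means of the Koszul
    cohomology H^j(x; S/J) of the variables, for ideals J of S.

    Regular sequences.  A regular sequence of length r in the graded maximal
    ideal forces H^j = 0 for j < r ([kvanish_regular]), because f in (x) acts
    as zero on cohomology.  Conversely, this vanishing yields such a sequence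
    ([regular_seq_of_kvanish]): H^0 (x; S/J) = 0 says that no nonzero element
    of S/J is killed by all variables, and prime avoidance in the Noetherian
    ring S then provides a nonzerodivisor.

    Lower bound.  Adding u_i to J = (u_1, ..., u_(i-1)) gives the exact sequence
    0 -> S/(J : u_i) -> S/J -> S/(J + u_i) -> 0, whose left-hand term is a
    polynomial ring in n - #|X_i| variables; so vanishing propagates along the
    ordering ([kvanish_adjoin], [kvanish_sqfree]).

    Upper bound.  If X_i is the whole complement of U_i then
    H^(2k-1) (x; S/I) <> 0.  In multidegree 0 the Koszul complex of S/I is the
    cochain complex of a simplicial complex (Hochster), and a class is found
    from a function g on d-sets that is carried by the U_j, has coboundary 0 and
    takes the value 1 at U_i ([full_covered_cocycle]); linear quotients act here
    like a shelling ([linear_quotient_acyclic]). *)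

Set Implicit Arguments.
Unset Strict Implicit.
Unset Printing Implicit Defensive.

Import Order.TTheory GRing.Theory.
Local Open Scope ring_scope.

(** * Ideals given by their membership predicates *)

Section IdealPredicates.

Variable R : comNzRingType.
Implicit Types (I J : R -> Prop) (A B : R -> Prop) (f g : R) (fs : seq R).

Definition is_ideal J : Prop :=
  [/\ J 0, forall f g, J f -> J g -> J (f + g) & forall r f, J f -> J (r * f)].

(** Lets ideals with the same members be exchanged by rewriting. *)
Lemma pred_ext I J : (forall f, I f <-> J f) -> I = J.
Proof.
move=> IJ; apply: functional_extensionality => f.
exact: propositional_extensionality.
Qed.

Lemma ideal0 J : is_ideal J -> J 0. Proof. by case. Qed.

Lemma idealD J f g : is_ideal J -> J f -> J g -> J (f + g).
Proof. by case=> _ + _; apply. Qed.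

Lemma idealMl J r f : is_ideal J -> J f -> J (r * f).
Proof. by case=> _ _; apply. Qed.

Lemma idealMr J r f : is_ideal J -> J f -> J (f * r).
Proof. by rewrite mulrC; apply: idealMl. Qed.

Lemma idealN J f : is_ideal J -> J f -> J (- f).
Proof. by rewrite -mulN1r; apply: idealMl. Qed.

Lemma idealB J f g : is_ideal J -> J f -> J g -> J (f - g).
Proof. by move=> iJ Jf Jg; apply: idealD => //; apply: idealN. Qed.

Lemma ideal_sum J (T : Type) (r : seq T) (P : pred T) (F : T -> R) :
  is_ideal J -> (forall t, P t -> J (F t)) -> J (\sum_(t <- r | P t) F t).
Proof.
by move=> iJ JF; elim/big_ind: _ => //; [apply: ideal0 | move=> *; apply: idealD].
Qed.

Lemma is_ideal_gen A : is_ideal (ideal_gen A).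
Proof.
split.
- by exists [::]; split=> //; rewrite big_nil.
- move=> f g [r [rA ->]] [s [sA ->]]; exists (r ++ s); rewrite big_cat; split=> //.
  by move=> p; rewrite mem_cat => /orP[/rA|/sA].
- move=> c f [r [rA ->]]; exists [seq (c * p.1, p.2) | p <- r]; split.
    by move=> p /mapP[q /rA qA ->].
  by rewrite big_map mulr_sumr; apply: eq_bigr => p _; rewrite mulrA.
Qed.

Lemma mem_ideal_gen A f : A f -> ideal_gen A f.
Proof.
move=> Af; exists [:: (1, f)]; split; first by move=> p; rewrite inE => /eqP->.
by rewrite big_seq1 mul1r.
Qed.

Lemma ideal_gen_min A J :
  is_ideal J -> (forall f, A f -> J f) -> forall f, ideal_gen A f -> J f.
Proof.
move=> iJ AJ f [r [rA ->]]; rewrite big_seq; apply: ideal_sum => // p /rA /AJ.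
exact: idealMl.
Qed.

Lemma ideal_gen_sub A B :
  (forall f, A f -> ideal_gen B f) -> forall f, ideal_gen A f -> ideal_gen B f.
Proof. by move=> AB; apply: ideal_gen_min => //; apply: is_ideal_gen. Qed.

Lemma is_ideal_add I J : is_ideal I -> is_ideal J -> is_ideal (ideal_add I J).
Proof.
move=> iI iJ; split.
- by exists 0, 0; split; rewrite ?addr0 //; apply: ideal0.
- move=> f g [a [b [Ia Jb ->]]] [c [d [Ic Jd ->]]].
  by exists (a + c), (b + d); split; rewrite 1?addrACA //; apply: idealD.
- move=> r f [a [b [Ia Jb ->]]].
  by exists (r * a), (r * b); split; rewrite ?mulrDr //; apply: idealMl.
Qed.

Lemma is_ideal_colon J u : is_ideal J -> is_ideal (colon J u).
Proof.
move=> iJ; split; rewrite /colon.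
- by rewrite mul0r; apply: ideal0.
- by move=> f g Jf Jg; rewrite mulrDl; apply: idealD.
- by move=> r f Jf; rewrite -mulrA; apply: idealMl.
Qed.

(** The ideal J + (f). *)
Definition adjoin J f : R -> Prop := fun g => exists a, J (g - a * f).

Lemma is_ideal_adjoin J f : is_ideal J -> is_ideal (adjoin J f).
Proof.
move=> iJ; split.
- by exists 0; rewrite mul0r subr0; apply: ideal0.
- move=> g h [a Ja] [b Jb]; exists (a + b).
  by rewrite mulrDl opprD addrACA; apply: idealD.
- by move=> r g [a Ja]; exists (r * a); rewrite -mulrA -mulrBr; apply: idealMl.
Qed.

Lemma sub_adjoin J f g : is_ideal J -> J g -> adjoin J f g.
Proof. by exists 0; rewrite mul0r subr0. Qed.

Lemma mem_adjoin J f : is_ideal J -> adjoin J f f.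
Proof. by exists 1; rewrite mul1r subrr; apply: ideal0. Qed.

Lemma adjoin_min I J f : is_ideal I -> (forall g, J g -> I g) -> I f ->
  forall g, adjoin J f g -> I g.
Proof.
move=> iI JI If g [a /JI Ig]; rewrite -(subrK (a * f) g).
by apply: idealD => //; apply: idealMl.
Qed.

Lemma ideal_gen_adjoin A B f : (forall g, B g <-> A g \/ g = f) ->
  ideal_gen B = adjoin (ideal_gen A) f.
Proof.
move=> BA; apply: pred_ext => g; have iA := is_ideal_gen A; split.
  apply: ideal_gen_min; first exact: is_ideal_adjoin.
  move=> h /BA [Ah|->]; last exact: mem_adjoin.
  by apply: sub_adjoin => //; apply: mem_ideal_gen.
apply: adjoin_min; first exact: is_ideal_gen.
  by apply: ideal_gen_sub => h Ah; apply/mem_ideal_gen/BA; left.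
by apply/mem_ideal_gen/BA; right.
Qed.

Definition add_seq J fs := ideal_add J (ideal_gen (fun f => f \in fs)).

Lemma is_ideal_add_seq J fs : is_ideal J -> is_ideal (add_seq J fs).
Proof. by move=> iJ; apply: is_ideal_add => //; apply: is_ideal_gen. Qed.

Lemma add_seq_nil J : is_ideal J -> add_seq J [::] = J.
Proof.
move=> iJ; apply: pred_ext => f; split.
  case=> a [b [Ja [r [r0 ->]] ->]]; rewrite big_seq big1 ?addr0 // => p /r0.
  by [].
move=> Jf; exists f, 0; split; rewrite ?addr0 //.
exact: ideal0 (is_ideal_gen _).
Qed.

Lemma add_seq_min I J fs : is_ideal I -> (forall g, J g -> I g) ->
  (forall f, f \in fs -> I f) -> forall g, add_seq J fs g -> I g.
Proof.
move=> iI JI fsI g [a [b [/JI Ia b_gen ->]]]; apply: idealD => //.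
exact: ideal_gen_min b_gen.
Qed.

Lemma add_seq_rcons J fs f : is_ideal J ->
  add_seq J (rcons fs f) = adjoin (add_seq J fs) f.
Proof.
move=> iJ; have iJfs := is_ideal_add_seq fs iJ; have iG := is_ideal_gen (fun f => f \in fs).
apply: pred_ext => g; split.
  apply: add_seq_min; first exact: is_ideal_adjoin.
    move=> h Jh; apply: sub_adjoin => //; exists h, 0; rewrite addr0.
    by split=> //; apply: ideal0.
  move=> h; rewrite mem_rcons inE => /orP[/eqP->|h_fs]; first exact: mem_adjoin.
  apply: sub_adjoin => //; exists 0, h; rewrite add0r.
  by split=> //; [apply: ideal0 | apply: mem_ideal_gen].
apply: adjoin_min; first exact: is_ideal_add_seq.
  move=> h; case=> a [b [Ja b_gen ->]]; exists a, b; split=> //.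
  by apply: ideal_gen_sub b_gen => c c_fs; apply: mem_ideal_gen;
     rewrite mem_rcons inE c_fs orbT.
exists 0, f; rewrite add0r; split=> //; first exact: ideal0.
by apply: mem_ideal_gen; rewrite mem_rcons mem_head.
Qed.

End IdealPredicates.

(** * Koszul cochains *)

Section Koszul.

Variables (n : nat).
Implicit Types (A B : {set 'I_n}) (a b : 'I_n).

Variable R : comNzRingType.
Variable v : 'I_n -> R.
Implicit Types (w z y : {set 'I_n} -> R) (J P : R -> Prop) (c : 'I_n -> R).

Definition ksign a A : R := (-1) ^+ #|[set b in A | (b < a)%N]|.

Lemma ksignU1 a b A : b \notin A ->
  ksign a (b |: A) = ksign a A * (-1) ^+ (b < a)%N.
Proof.
move=> bA; rewrite /ksign -exprD; congr (_ ^+ _); case: ltnP => ba.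
  rewrite (_ : [set _ in _ | _] = b |: [set c in A | (c < a)%N]).
    by rewrite cardsU1 !inE (negPf bA) addnC.
  by apply/setP => c; rewrite !inE; case: eqP => [->|//]; rewrite ba.
rewrite addn0; congr #|pred_of_set _|; apply/setP => c; rewrite !inE.
by case: eqP => [->|//]; rewrite ltnNge ba /= andbF.
Qed.

Lemma ksign_self a A : ksign a (a |: A) = ksign a A.
Proof.
congr (_ ^+ _); congr #|pred_of_set _|; apply/setP => c; rewrite !inE.
by case: eqP => [->|//]; rewrite ltnn !andbF.
Qed.

Lemma ksign_sqr a A : ksign a A * ksign a A = 1.
Proof. by rewrite -expr2 sqrr_sign. Qed.

Lemma sign_lt_anti a b : a != b ->
  (-1) ^+ (a < b)%N = - (-1) ^+ (b < a)%N :> R.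
Proof. by rewrite -val_eqE /=; case: ltngtP; rewrite //= opprK. Qed.

(** A cochain assigns to A the coefficient of the exterior product of the basis
    vectors e_a, a in A, in increasing order; [kdiff] is the exterior product
    with \sum_a v_a e_a and [kcontr c] the contraction by the linear form of
    coefficients c. All degrees are kept together, #|A| being the degree. *)
Definition kdiff w A : R := \sum_(a in A) ksign a A * v a * w (A :\ a).

Definition kcontr c w A : R :=
  \sum_(a | a \notin A) ksign a A * c a * w (a |: A).

Lemma kdiffD w z A : kdiff (fun B => w B + z B) A = kdiff w A + kdiff z A.
Proof. by rewrite -big_split; apply: eq_bigr => a _; rewrite mulrDr. Qed.

Lemma kdiffB w z A : kdiff (fun B => w B - z B) A = kdiff w A - kdiff z A.
Proof. by rewrite -sumrB; apply: eq_bigr => a _; rewrite mulrBr. Qed.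

Lemma kdiffZ f w A : kdiff (fun B => f * w B) A = f * kdiff w A.
Proof. by rewrite mulr_sumr; apply: eq_bigr => a _; rewrite mulrCA. Qed.

Lemma eq_kdiff w z A : (forall B, #|B|.+1 = #|A| -> w B = z B) ->
  kdiff w A = kdiff z A.
Proof.
move=> wz; apply: eq_bigr => a aA; congr (_ * _); apply: wz.
by rewrite (cardsD1 a A) aA.
Qed.

Lemma kdiff_ideal J w A : is_ideal J ->
  (forall B, #|B|.+1 = #|A| -> J (w B)) -> J (kdiff w A).
Proof.
move=> iJ wJ; apply: ideal_sum => // a aA; apply: idealMl => //; apply: wJ.
by rewrite (cardsD1 a A) aA.
Qed.

(** The terms removing a then b and b then a carry opposite signs. *)
Lemma kdiff_kdiff w A : kdiff (kdiff w) A = 0.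
Proof.
pose F a b := ksign a A * ksign b (A :\ a) * v a * v b * w (A :\ a :\ b).
have Fanti a b : a \in A -> b \in A -> a != b -> F a b = - F b a.
  move=> aA bA ab.
  have sgn i j : i \in A -> j \in A ->
      ksign i A = ksign i (A :\ j) * (-1) ^+ (j < i)%N.
    by move=> iA jA; rewrite -[in LHS](setD1K jA) ksignU1 // setD11.
  rewrite /F (sgn a b) // (sgn b a) // (sign_lt_anti ab).
  rewrite (_ : A :\ b :\ a = A :\ a :\ b); first by ring.
  by apply/setP => x; rewrite !inE andbCA.
have -> : kdiff (kdiff w) A =
    \sum_(a in A) \sum_(b in A | b != a) F a b.
  apply: eq_bigr => a aA; rewrite mulr_sumr; apply: eq_big => [b|b _].
    by rewrite !inE andbC.
  by rewrite /F; ring.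
transitivity (\sum_(a in A) \sum_(b in A | (a < b)%N) F a b +
              \sum_(a in A) \sum_(b in A | (b < a)%N) F a b).
  rewrite -big_split; apply: eq_bigr => a aA.
  rewrite (bigID (fun b : 'I_n => (a < b)%N)) /=; congr (_ + _); apply: eq_bigl => b.
    by rewrite -val_eqE /=; case: ltngtP; rewrite ?andbF ?andbT.
  by rewrite -val_eqE /=; case: ltngtP; rewrite ?andbF ?andbT.
rewrite [X in _ + X](exchange_big_dep (mem A)) //=; last by move=> a b _ /andP[].
rewrite -big_split big1 //= => a aA.
rewrite [X in _ + X](eq_bigl (fun b => (b \in A) && (a < b)%N)); last first.
  by move=> b; rewrite aA.
rewrite -big_split big1 //= => b /andP[bA ab].
by rewrite Fanti ?addNr // neq_ltn ab.
Qed.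

(** Contraction by c is a homotopy between 0 and multiplication by
    \sum_a c_a v_a, which therefore acts as zero on cohomology. *)
Lemma kdiff_contr c w A :
  kdiff (kcontr c w) A + kcontr c (kdiff w) A = (\sum_a c a * v a) * w A.
Proof.
pose F a b := ksign a A * ksign b A * v a * c b * w (b |: A :\ a).
have -> : kdiff (kcontr c w) A = \sum_(a in A) c a * v a * w A +
    \sum_(a in A) \sum_(b | b \notin A) F a b * (-1) ^+ (a < b)%N.
  rewrite -big_split; apply: eq_bigr => a aA.
  rewrite /kcontr (bigD1 a) /= ?setD11 // setD1K //.
  rewrite mulrDr; congr (_ + _).
    have := ksign_sqr a (A :\ a); rewrite -[in ksign a A](setD1K aA) ksign_self.
    by move=> s2; rewrite -[RHS]mul1r -s2; ring.
  rewrite mulr_sumr; apply: eq_big => [b|b].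
    by rewrite !inE negb_and negbK; case: eqP => [->|]; rewrite ?aA ?andbT.
  rewrite !inE => /andP[_ ba].
  rewrite /F -[in ksign b A](setD1K aA) ksignU1 ?setD11 //.
  have := sqrr_sign R (a < b)%N; rewrite expr2 => s2.
  rewrite -[LHS]mul1r -{1}s2; ring.
have -> : kcontr c (kdiff w) A = \sum_(b | b \notin A) c b * v b * w A +
    \sum_(b | b \notin A) \sum_(a in A) F a b * (-1) ^+ (b < a)%N.
  rewrite -big_split; apply: eq_bigr => b bA.
  rewrite /kdiff (bigD1 b) /= ?setU11 // mulrDr setU1K //; congr (_ + _).
    by rewrite ksign_self -[RHS]mul1r -(ksign_sqr b A); ring.
  rewrite mulr_sumr; apply: eq_big => [a|a].
    by rewrite !inE; case: eqP => [->|]; rewrite ?(negPf bA) ?andbT.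
  rewrite !inE => /andP[/orP[/eqP->|aA] ab]; first by rewrite eqxx in ab.
  rewrite /F ksignU1 // (_ : (b |: A) :\ a = b |: A :\ a); first by ring.
  apply/setP => x; rewrite !inE; case: (eqVneq x a) => //= ->.
  by rewrite (negPf ab).
rewrite [X in _ + (_ + X)]exchange_big addrACA -[RHS]addr0; congr (_ + _).
  by rewrite mulr_suml [RHS](bigID (mem A)) /=.
rewrite -big_split big1 //= => a aA; rewrite -big_split big1 //= => b bA.
rewrite sign_lt_anti; first by rewrite mulrN addNr.
by apply: contraNneq bA => <-.
Qed.

(** [kvanish J i] says that H^(i-1) (v; R/J) = 0. The shift by one makes the
    case i = 0 vacuous, which starts all inductions on i. *)
Definition kvanish J i : Prop := forall z,
  (forall B, #|B| = i -> J (kdiff z B)) ->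
  exists y, forall A, #|A|.+1 = i -> J (z A - kdiff y A).

Lemma kvanish0 J : kvanish J 0.
Proof. by move=> z _; exists (fun=> 0). Qed.

(** From 0 -> R/J -> R/J -> R/(J + f) -> 0: multiplication by f is injective on
    the cohomology of R/J in the next degree, yet it is zero there as f lies in
    the ideal of v. Explicitly, a cocycle z has f z homologous to 0 through the
    contraction of z, and that contraction is a cocycle modulo J + f. *)
Lemma kvanish_nzd J c i : is_ideal J ->
  nonzerodivisor_mod J (\sum_a c a * v a) ->
  kvanish (adjoin J (\sum_a c a * v a)) i -> kvanish J i.+1.
Proof.
set f := \sum_a _ => iJ f_nzd van z z_cocycle.
have dw A : #|A| = i -> J (f * z A - kdiff (kcontr c z) A).
  move=> Ai; rewrite -kdiff_contr addrAC subrr add0r.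
  apply: ideal_sum => // b bA; apply: idealMl => //; apply: z_cocycle.
  by rewrite cardsU1 bA Ai.
have [|q Hq] := van (kcontr c z).
  move=> A /dw Jd; exists (z A); rewrite -opprB mulrC.
  by apply: idealN.
have [y Hy] : exists y, forall A, #|A|.+1 = i ->
    J (kcontr c z A - kdiff q A - f * y A).
  have [A|y Hy] := choice (fun A r => #|A|.+1 = i ->
      J (kcontr c z A - kdiff q A - f * r)); last by exists y.
  have [Ai|Ai] := eqVneq #|A|.+1 i; last by exists 0 => /eqP; rewrite (negPf Ai).
  by have [r Jr] := Hq A Ai; exists r; rewrite mulrC.
exists y => A [Ai]; apply: f_nzd.
have := @kdiff_ideal J _ A iJ; rewrite Ai => /(_ _ Hy).
rewrite !kdiffB kdiff_kdiff subr0 kdiffZ => Jy.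
by have := idealD iJ (dw A Ai) Jy; rewrite mulrBr addrA subrK.
Qed.

(** The long exact sequence of 0 -> R/(J : u) -> R/J -> R/(J + u) -> 0. It serves
    twice: for a generator u of an ideal with linear quotients, and for u a
    nonzerodivisor modulo J, where J : u = J. *)
Lemma kvanish_adjoin J u i : is_ideal J ->
  kvanish (colon J u) i.+1 -> kvanish J i -> kvanish (adjoin J u) i.
Proof.
move=> iJ vanP vanJ z z_cocycle.
have [g Hg] : exists g, forall B, #|B| = i -> J (kdiff z B - g B * u).
  have [B|g Hg] := choice (fun B r => #|B| = i -> J (kdiff z B - r * u)); last by exists g.
  have [Bi|Bi] := eqVneq #|B| i; last by exists 0 => /eqP; rewrite (negPf Bi).
  by have [r Jr] := z_cocycle B Bi; exists r.
(* g represents the connecting homomorphism: u (d g) = d (d z) = 0 modulo J. *)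
have [D Di|p Hp] := vanP g.
  have := @kdiff_ideal J (fun B => kdiff z B - u * g B) D iJ.
  rewrite Di kdiffB kdiff_kdiff kdiffZ sub0r mulrC => H.
  rewrite /colon -[_ * u]opprK; apply: idealN => //; apply: H => B [Bi].
  by rewrite mulrC; apply: Hg.
have [B Bi|y Hy] := vanJ (fun A => z A - u * p A).
  rewrite kdiffB kdiffZ.
  have := idealD iJ (Hg B Bi) (Hp B (congr1 S Bi)).
  by rewrite mulrBl addrA subrK [_ * u]mulrC.
exists y => A Ai; exists (p A).
by have := Hy A Ai; rewrite addrAC mulrC.
Qed.

Lemma colon_nzd J f : is_ideal J -> nonzerodivisor_mod J f -> colon J f = J.
Proof.
move=> iJ f_nzd; apply: pred_ext => g; rewrite /colon mulrC; split.
  exact: f_nzd.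
exact: idealMl.
Qed.

(** H^0 (v; R/J) consists of the classes killed by all v a. *)
Lemma kvanish1 J g : is_ideal J -> kvanish J 1 ->
  (forall a, J (v a * g)) -> J g.
Proof.
move=> iJ van Jv; have [B /eqP/cards1P[b ->]|y] := van (fun=> g).
  by apply: ideal_sum => // a _; rewrite -mulrA; apply: idealMl.
by move=> /(_ set0 (congr1 S (cards0 _))); rewrite /kdiff big_set0 subr0.
Qed.

(** H^n (v; R/J) = R/(J + (v)) does not vanish; this bounds the length of regular
    sequences by n. *)
Lemma not_kvanish_top J m : is_ideal J -> is_ideal m -> ~ m 1 ->
  (forall f, J f -> m f) -> (forall a, m (v a)) -> ~ kvanish J n.+1.
Proof.
move=> iJ im m1 Jm mv van; apply: m1.
have [B Bn|y /(_ setT)] := van (fun=> 1).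
  by have := max_card (mem B); rewrite Bn card_ord ltnn.
rewrite cardsT card_ord => /(_ erefl)/Jm m1y.
rewrite -(subrK (kdiff y setT) 1); apply: idealD => //.
apply: ideal_sum => // a _; rewrite mulrAC.
exact: idealMl.
Qed.

Lemma kvanish_regular J fs : is_ideal J -> regular_seq J fs ->
  (forall f, f \in fs -> exists c, f = \sum_a c a * v a) ->
  forall i, (i <= size fs)%N -> kvanish J i.
Proof.
move=> iJ [fs_reg _] fs_v.
suff van i j : (i + j <= size fs)%N -> kvanish (add_seq J (take j fs)) i.
  by move=> i le_i; have := van i 0%N; rewrite addn0 take0 add_seq_nil //; apply.
elim: i j => [|i IHi] j le_ij; first exact: kvanish0.
have lt_j : (j < size fs)%N by lia.
have [c fs_j] := fs_v _ (mem_nth 0 lt_j).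
have /= := fs_reg j lt_j; rewrite -/(add_seq _ _) fs_j => j_nzd.
apply: (kvanish_nzd (is_ideal_add_seq _ iJ) j_nzd).
by rewrite -fs_j -add_seq_rcons // -take_nth //; apply: IHi; rewrite addnS.
Qed.

End Koszul.

(** * Regular elements in Noetherian rings *)

(** The ascending chain condition, in the form in which it is both used and
    proved below. *)
Definition noetherian (R : comNzRingType) : Prop := forall a : nat -> R,
  exists k, ideal_gen (fun f => exists2 i, (i < k)%N & f = a i) (a k).

Section Noetherian.

Variable R : comNzRingType.
Hypothesis noethR : noetherian R.
Implicit Types (I J : R -> Prop) (f g : R).

(** A strictly ascending chain I (t 0), I (t 1), ... would give elements
    f k of I (t k.+1) outside I (t k), none in the ideal of the previous ones. *)
Lemma noetherian_maximal (T : Type) (P : T -> Prop) (I : T -> R -> Prop) t0 :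
    (forall t, is_ideal (I t)) -> P t0 ->
  exists t, [/\ P t, forall f, I t0 f -> I t f &
    forall s, P s -> (forall f, I t f -> I s f) -> forall f, I s f -> I t f].
Proof.
move=> iI Pt0; apply: NNPP => nomax.
pose Q t := P t /\ (forall f, I t0 f -> I t f).
have next t : exists p : T * R, Q t ->
    [/\ Q p.1, forall f, I t f -> I p.1 f, I p.1 p.2 & ~ I t p.2].
  apply: NNPP => no_next; apply: nomax.
  have [Qt | nQt] := classic (Q t); last by case: no_next; exists (t0, 0).
  exists t; case: (Qt) => Pt t0t; split=> // s Ps ts f sf; apply: NNPP => tf.
  by case: no_next; exists (s, f) => _; split=> //; split=> // g /t0t /ts.
have [nx nxP] := choice _ next.
pose t k := iter k (fun x => (nx x).1) t0.
have Qt k : Q (t k) by elim: k => [|k /nxP[]//]; split.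
have le_t i k : (i <= k)%N -> forall f, I (t i) f -> I (t k) f.
  elim: k => [|k IHk]; first by rewrite leqn0 => /eqP->.
  rewrite leq_eqVlt ltnS => /orP[/eqP->//|/IHk ik f /ik].
  by have [_ + _ _] := nxP _ (Qt k); apply.
have [k] := noethR (fun k => (nx (t k)).2).
have [_ _ _ + gen_k] := nxP _ (Qt k); apply.
apply: ideal_gen_min gen_k; first exact: iI.
move=> f [i lt_ik ->]; apply: (le_t i.+1 k lt_ik).
by have [] := nxP _ (Qt i).
Qed.

Lemma noetherian_fg (A : R -> Prop) : exists r : seq R,
  (forall a, a \in r -> A a) /\ (forall a, A a -> ideal_gen (fun f => f \in r) a).
Proof.
pose P (r : seq R) := forall a, a \in r -> A a.
have [||r [Pr _ rmax]] := @noetherian_maximal _ P (fun r => ideal_gen (fun f => f \in r)) [::].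
- by move=> r; apply: is_ideal_gen.
- by [].
exists r; split=> // a Aa; apply: (rmax (a :: r)).
- by move=> b; rewrite inE => /orP[/eqP->//|/Pr].
- by apply: ideal_gen_sub => f f_r; apply: mem_ideal_gen; rewrite inE f_r orbT.
- by apply: mem_ideal_gen; rewrite mem_head.
Qed.

Section PrimeAvoidance.

Variables J m : R -> Prop.
Hypotheses (iJ : is_ideal J) (im : is_ideal m).

(** [colon J a] is the annihilator of a in R/J. The maximal ones among those of
    nonzero elements are primes associated with J. *)
Definition maximal_ann (a : R) : Prop := ~ J a /\
  forall b, ~ J b -> (forall f, colon J a f -> colon J b f) ->
    forall f, colon J b f -> colon J a f.

Lemma maximal_ann_prime a f g : maximal_ann a ->
  colon J a (f * g) -> colon J a f \/ colon J a g.
Proof.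
move=> [Ja amax] Jfg; have [Jg | nJg] := classic (colon J a g); [by right | left].
apply: (amax (g * a) nJg); last by rewrite /colon mulrA.
by move=> h Jh; rewrite /colon mulrCA; apply: idealMl.
Qed.

(** A prime containing an intersection of ideals contains one of them; here as
    the product of elements that separate each ideal from the prime. *)
Lemma prime_witness a (s : seq R) : maximal_ann a ->
  (forall b, b \in s -> exists2 h, colon J b h & ~ colon J a h) ->
  exists2 g, (forall b, b \in s -> colon J b g) & ~ colon J a g.
Proof.
move=> amax; elim: s => [_ | b s IHs Hs].
  by exists 1; rewrite // /colon mul1r; case: amax.
have [c cs | g gs nag] := IHs; first by apply: Hs; rewrite inE cs orbT.
have [h bh nah] := Hs b (mem_head _ _).
exists (h * g); last by move=> /(maximal_ann_prime amax)[].
move=> c; rewrite inE => /orP[/eqP->|/gs cg]; first exact: (idealMr _ (is_ideal_colon _ iJ)).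
exact: (idealMl _ (is_ideal_colon _ iJ)).
Qed.

(** Prime avoidance is easier for maximal annihilators than for arbitrary primes:
    when two of them are comparable, they are equal. *)
Lemma prime_avoidance (s : seq R) :
  (forall a, a \in s -> maximal_ann a) ->
  (forall a, ~ J a -> exists2 f, m f & ~ colon J a f) ->
  exists2 f, m f & forall a, a \in s -> ~ colon J a f.
Proof.
move=> + mann; elim: s => [_ | a s IHs smax].
  by exists 0 => //; apply: ideal0.
have amax : maximal_ann a by apply: smax; rewrite mem_head.
have {}smax b : b \in s -> maximal_ann b by move=> bs; apply: smax; rewrite inE bs orbT.
have [f mf fs] := IHs smax.
have [af | naf] := classic (colon J a f); last first.
  by exists f => // b; rewrite inE => /orP[/eqP->|/fs].
have iC b := is_ideal_colon b iJ.
have [b bs | g gs nag] := prime_witness (s := s) amax.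
  apply: NNPP => sub_ba; case: (fs b bs).
  have [nJb bmax] := smax b bs; apply: (bmax a _ _ f af); first by case: amax.
  by move=> h bh; apply: NNPP => nah; apply: sub_ba; exists h.
have [y my nay] := mann a (proj1 amax).
exists (f + y * g); first by apply: idealD => //; apply: idealMr.
move=> b; rewrite inE => /orP[/eqP->|bs] Cfg.
  have : colon J a (y * g) by rewrite -[_ * _](addKr f) addrC; apply: (idealB (iC _)).
  by case/(maximal_ann_prime amax).
case: (fs b bs); rewrite -(addrK (y * g) f); apply: (idealB (iC _)) => //.
by apply: (idealMl _ (iC _)); apply: gs.
Qed.

(** Every zero divisor modulo J lies in a maximal annihilator, and finitely many of
    these suffice: if r generates the ideal of all a with a maximal annihilator,
    then the annihilator of such an a contains the intersection of those of r,
    hence one of them. *)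
Lemma exists_nonzerodivisor :
  (forall a, ~ J a -> exists2 f, m f & ~ colon J a f) ->
  exists2 f, m f & nonzerodivisor_mod J f.
Proof.
move=> mann.
have [r [rmax rgen]] := noetherian_fg maximal_ann.
have [f mf fr] := prime_avoidance rmax mann; exists f => // g Jfg.
apply: NNPP => nJg.
have [||a [nJa ga amax]] := @noetherian_maximal _ (fun a => ~ J a) (colon J) g.
- by move=> a; apply: is_ideal_colon.
- by [].
have {}amax : maximal_ann a by split.
have [b br ba] : exists2 b, b \in r & forall h, colon J b h -> colon J a h.
  apply: NNPP => no_b; have [b br | h hr nah] := prime_witness (s := r) amax.
    apply: NNPP => sub_ba; apply: no_b; exists b => // h bh.
    by apply: NNPP => nah; apply: sub_ba; exists h.
  (* h kills the generators in r, hence a, which they generate. *)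
  apply: nah; rewrite /colon mulrC -/(colon J h a).
  apply: ideal_gen_min (rgen a amax); first exact: is_ideal_colon.
  by move=> b /hr; rewrite /colon mulrC.
case: (fr b br); have [nJb bmax] := rmax b br.
by apply: (bmax a nJa ba); apply: ga.
Qed.

End PrimeAvoidance.

(** Vanishing of H^0 yields a nonzerodivisor f in m, and the long exact sequence of
    multiplication by f passes the vanishing on to J + f in one degree less. *)
Lemma regular_seq_of_kvanish n (v : 'I_n -> R) J m r :
    is_ideal J -> is_ideal m -> ~ m 1 -> (forall f, J f -> m f) ->
    (forall a, m (v a)) ->
    (forall i, (i <= r)%N -> kvanish v J i) ->
  exists fs, [/\ size fs = r, forall f, f \in fs -> m f & regular_seq J fs].
Proof.
move=> iJ im m1 Jm mv van.
suff [fs [fs_r mfs fs_reg _]] : exists fs : seq R,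
    [/\ size fs = r, forall f, f \in fs -> m f,
       forall i, (i < size fs)%N -> nonzerodivisor_mod (add_seq J (take i fs)) fs`_i
     & forall i, (i + size fs <= r)%N -> kvanish v (add_seq J fs) i].
  exists fs; split=> //; split=> // /(add_seq_min im Jm mfs).
  exact: m1.
suff: forall j, (j <= r)%N -> exists fs : seq R,
    [/\ size fs = j, forall f, f \in fs -> m f,
       forall i, (i < size fs)%N -> nonzerodivisor_mod (add_seq J (take i fs)) fs`_i
     & forall i, (i + size fs <= r)%N -> kvanish v (add_seq J fs) i].
  by apply.
elim=> [_ | j IHj lt_jr].
  exists [::]; split=> // i; rewrite addn0 add_seq_nil //; exact: van.
have [fs [fs_j mfs fs_reg fs_van]] := IHj (ltnW lt_jr).
have iJfs := is_ideal_add_seq fs iJ.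
have [a nJa | f mf f_nzd] := exists_nonzerodivisor (m := m) iJfs im.
  apply: NNPP => no_f; apply: nJa; apply: (kvanish1 iJfs (v := v)).
    by apply: fs_van; rewrite fs_j.
  by move=> b; apply: NNPP => nJb; apply: no_f; exists (v b).
exists (rcons fs f); split.
- by rewrite size_rcons fs_j.
- by move=> g; rewrite mem_rcons inE => /orP[/eqP->|/mfs].
- move=> i; rewrite size_rcons ltnS leq_eqVlt => /orP[/eqP->|lt_i].
    by rewrite -cats1 take_size_cat // nth_cat ltnn subnn.
  by rewrite -cats1 takel_cat ?(ltnW lt_i) // nth_cat lt_i; apply: fs_reg.
- move=> i; rewrite size_rcons add_seq_rcons // => le_i.
  apply: kvanish_adjoin => //.
    by rewrite colon_nzd //; apply: fs_van; rewrite addSnnS.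
  by apply: fs_van; apply: leq_trans le_i; rewrite leq_add2l.
Qed.

End Noetherian.

(** * Polynomial rings are Noetherian *)

(** Choose repeatedly an index where the rest of the sequence attains its minimum. *)
Lemma nondecreasing_subsequence (s : nat -> nat) :
  exists phi : nat -> nat, forall i j, (i < j)%N ->
    (phi i < phi j)%N /\ (s (phi i) <= s (phi j))%N.
Proof.
have tail_min k : exists l, (k <= l)%N /\ forall l', (k <= l')%N -> (s l <= s l')%N.
  suff min N l : (s l < N)%N -> (k <= l)%N ->
      exists l, (k <= l)%N /\ forall l', (k <= l')%N -> (s l <= s l')%N.
    exact: min (ltnSn (s k)) (leqnn k).
  elim: N l => // N IHN l sl kl.
  have [[l' kl' sl'] | no_l] := classic (exists2 l', (k <= l')%N & (s l' < s l)%N).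
    by apply: IHN kl'; apply: leq_trans sl' _.
  exists l; split=> // l' kl'; rewrite leqNgt; apply/negP => lt_s.
  by apply: no_l; exists l'.
have [mn mnP] := choice _ tail_min.
pose phi i := iter i (fun l => mn l.+1) (mn 0%N).
have phiS i : (phi i < phi i.+1)%N by have [] := mnP (phi i).+1.
have lt_phi : {homo phi : i j / (i < j)%N} by apply: homo_ltn => //; apply: ltn_trans.
exists phi => i j ij; split; first exact: lt_phi.
case: i ij => [|i] ij; first by have [_] := mnP 0%N; apply.
have [_] := mnP (phi i).+1; apply; apply: ltn_trans (phiS i) _.
exact: lt_phi.
Qed.

(** Extract successive subsequences that are nondecreasing in one more coordinate. *)
Lemma dickson n (u : nat -> 'X_{1..n}) : exists i j, (i < j)%N /\ (u i <= u j)%MM.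
Proof.
suff [phi phiP] : exists phi : nat -> nat, forall i j, (i < j)%N ->
    (phi i < phi j)%N /\ forall a, a \in enum 'I_n -> (u (phi i) a <= u (phi j) a)%N.
  exists (phi 0%N), (phi 1%N); have [lt_phi le_u] := phiP 0%N 1%N isT; split=> //.
  by apply/mnm_lepP => a; apply: le_u; rewrite mem_enum.
elim: (enum _) => [|b r [phi phiP]]; first by exists id.
have [psi psiP] := nondecreasing_subsequence (fun i => u (phi i) b).
exists (phi \o psi) => i j /psiP[/phiP[lt_phi le_u] le_b]; split=> // a.
by rewrite inE => /orP[/eqP->//|/le_u].
Qed.

Section Lead.

Variables (K : fieldType) (n : nat).
Local Notation S := {mpoly K[n]}.

Lemma lead_reduction (g h : S) : h != 0 -> (mlead h <= mlead g)%MM ->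
  exists r, g - r * h = 0 \/ (mlead (g - r * h) < mlead g)%O.
Proof.
move=> h0 le_hg; have [g0|g0] := eqVneq g 0.
  by exists 0; left; rewrite g0 mul0r subr0.
pose c := mleadc g / mleadc h.
have c0 : c != 0 by rewrite mulf_neq0 ?invr_eq0 ?mleadc_eq0.
pose r : S := c *: 'X_[mlead g - mlead h]; exists r.
have r0 : r != 0 by rewrite -mleadc_eq0 mleadcZE mleadXm mcoeffX eqxx mulr1.
have lead_rh : mlead (r * h) = mlead g.
  by rewrite mleadM // mleadZ // mleadXm submK.
have [->|d0] := eqVneq (g - r * h) 0; [by left | right].
rewrite lt_neqAle -{2}[mlead g]joinxx -{3}lead_rh mleadB_le andbT.
apply: contraNneq d0 => lead_d; rewrite -mleadc_eq0 lead_d mcoeffB.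
rewrite -{2}lead_rh mleadM // mleadcM mleadcZE mleadXm mcoeffX eqxx mulr1.
by rewrite divfK ?subrr // mleadc_eq0.
Qed.

(** If a k were never in the ideal J k of the previous terms, reduce it modulo J k
    to g k with minimal leading monomial. The leading monomial of g k is then
    divisible by that of no element of J k, in particular of no g i, i < k,
    which contradicts Dickson's lemma. *)
Lemma mpoly_noetherian : noetherian S.
Proof.
move=> a; apply: NNPP => bad.
pose J k := ideal_gen (fun f : S => exists2 i, (i < k)%N & f = a i).
have iJ k : is_ideal (J k) by apply: is_ideal_gen.
have Ja k : ~ J k (a k) by move=> Jk; apply: bad; exists k.
have reduce k : exists g, J k (a k - g) /\
    forall h, J k h -> h != 0 -> ~ (mlead h <= mlead g)%MM.
  suff red u g : mlead g = u -> J k (a k - g) -> exists g, J k (a k - g) /\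
      forall h, J k h -> h != 0 -> ~ (mlead h <= mlead g)%MM.
    by apply: (red _ (a k)); rewrite // subrr; apply: ideal0.
  elim/(@ltmwf n): u g => u IHu g gu Jg.
  have [[h [Jh h0 hg]] | no_h] :=
      classic (exists h, [/\ J k h, h != 0 & (mlead h <= mlead g)%MM]); last first.
    by exists g; split=> // h Jh h0 hg; apply: no_h; exists h.
  have [r r_red] := lead_reduction h0 hg.
  have Jr : J k (a k - (g - r * h)).
    by rewrite opprB addrA addrAC; apply: idealD => //; apply: idealMl.
  case: r_red => [d0 | lt_d]; first by rewrite d0 subr0 in Jr; case: (Ja k).
  by apply: (IHu _ _ _ (erefl _) Jr); rewrite -gu.
have [g gP] := choice _ reduce.
have [i [j [ij le_g]]] := dickson (fun k => mlead (g k)).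
have [Jgi _] := gP i; have [_ /(_ (g i))gj] := gP j; apply: gj le_g.
  have JiJ f : J i f -> J j f.
    apply: ideal_gen_sub => _ [l li ->]; apply: mem_ideal_gen.
    by exists l; rewrite // (ltn_trans li).
  rewrite -[g i](subKr (a i)); apply: idealB (JiJ _ Jgi) => //.
  by apply: mem_ideal_gen; exists i.
by apply/eqP => gi0; rewrite gi0 subr0 in Jgi; case: (Ja i).
Qed.

End Lead.

(** * Monomial ideals *)

Section MonomialIdeals.

Variables (K : fieldType) (n : nat).
Local Notation S := {mpoly K[n]}.
Implicit Types (f g : S) (X U : {set 'I_n}) (u : 'X_{1..n}).

Lemma monomial_genP (A : 'X_{1..n} -> Prop) f :
  ideal_gen (fun f : S => exists2 u, A u & f = 'X_[u]) f <->
  (forall m, f@_m != 0 -> exists2 u, A u & (u <= m)%MM).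
Proof.
split=> [|Af].
  move: f; apply: ideal_gen_min => [|_ [u Au ->] m].
    split=> [m|f g Af Ag m|r f Af m]; first by rewrite mcoeff0 eqxx.
      rewrite mcoeffD; have [-> | /Af//] := eqVneq f@_m 0.
      by rewrite add0r; apply: Ag.
    rewrite -mcoeff_msupp => /msuppM_le /allpairsP[[m1 m2] /= [_ m2f ->]].
    have [|u Au um] := Af m2; first by rewrite -mcoeff_msupp.
    by exists u => //; apply: lepm_trans um (lem_addl _ _).
  by rewrite mcoeffX; case: (u =P m) => [<- _|_]; [exists u; rewrite ?lepm_refl | rewrite /= eqxx].
rewrite [f]mpolyE big_seq; apply: ideal_sum; first exact: is_ideal_gen.
move=> m; rewrite mcoeff_msupp => /Af[u Au um].
rewrite -(submK um) mpolyXD scalerAl; apply: idealMl; first exact: is_ideal_gen.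
by apply: mem_ideal_gen; exists u.
Qed.


Lemma monomial_colonP (A : 'X_{1..n} -> Prop) u f :
  colon (ideal_gen (fun f : S => exists2 w, A w & f = 'X_[w])) 'X_[u] f <->
  (forall m, f@_m != 0 -> exists2 w, A w & (w <= u + m)%MM).
Proof.
rewrite /colon; split=> [/monomial_genP Af m fm | Af].
  by apply: Af; rewrite mcoeffMX.
apply/monomial_genP => m; rewrite -mcoeff_msupp => m_fu.
have: m \in [seq (u + w)%MM | w <- msupp f] by rewrite -(perm_mem (msuppMX _ _)).
by case/mapP=> w; rewrite mcoeff_msupp => /Af[w' Aw' w'u] ->; exists w'.
Qed.

Lemma var_idealE X : @var_ideal K n X =
  ideal_gen (fun f => exists2 u, (exists2 i, i \in X & u = U_(i)%MM) & f = 'X_[u]).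
Proof.
congr ideal_gen; apply: pred_ext => f; split.
  by case=> i iX ->; exists U_(i)%MM; [exists i|].
by case=> u [i iX ->] ->; exists i.
Qed.

Lemma var_idealP X f : var_ideal X f <->
  (forall m, f@_m != 0 -> exists2 i, i \in X & (0 < m i)%N).
Proof.
rewrite var_idealE monomial_genP; split=> Xf m /Xf.
  by case=> _ [i iX ->]; rewrite lep1mP -lt0n; exists i.
by case=> i iX m_i; exists U_(i)%MM; [exists i | rewrite lep1mP -lt0n].
Qed.

Lemma mem_var_ideal X i : var_ideal X ('X_i : S) <-> i \in X.
Proof.
rewrite var_idealP; split=> [|iX m]; last first.
  rewrite mcoeffX; case: (U_(i)%MM =P m) => [<- _|_ /=]; last by rewrite eqxx.
  by exists i; rewrite // mnm1E eqxx.
case/(_ U_(i)%MM); first by rewrite mcoeffX eqxx oner_eq0.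
by move=> j jX; rewrite mnm1E; case: eqP => // ->.
Qed.

Lemma is_ideal_var X : is_ideal (@var_ideal K n X).
Proof. exact: is_ideal_gen. Qed.

Lemma var_ideal_adjoin X t : var_ideal (t |: X) = adjoin (var_ideal X) ('X_t : S).
Proof.
apply: ideal_gen_adjoin => f; split.
  by case=> i /setU1P[->|iX] ->; [right | left; exists i].
by case=> [[i iX ->]|->]; [exists i; rewrite // inE iX orbT | exists t; rewrite ?setU11].
Qed.

Lemma var_nonzerodivisor X t : t \notin X ->
  nonzerodivisor_mod (var_ideal X) ('X_t : S).
Proof.
move=> tX f /var_idealP Xf; apply/var_idealP => m fm.
have [|i iX] := Xf (U_(t) + m)%MM; first by rewrite mulrC mcoeffMX.
rewrite mnmDE mnm1E; case: eqP => [ti|_]; last by exists i.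
by rewrite -ti (negPf tX) in iX.
Qed.

(** Modulo X the remaining variables form a regular sequence. *)
Lemma kvanish_var_ideal X i : (i <= n - #|X|)%N ->
  kvanish (fun a => 'X_a : S) (var_ideal X) i.
Proof.
elim: i X => [|i IHi] X lt_i; first exact: kvanish0.
have /subsetPn[t _ tX]: ~~ ([set: 'I_n] \subset X).
  by apply/negP => /subset_leq_card; rewrite cardsT card_ord; lia.
have Et : \sum_a (a == t)%:R * 'X_a = 'X_t :> S.
  rewrite (bigD1 t) //= eqxx mul1r big1 ?addr0 // => a /negPf->.
  by rewrite mul0r.
apply: (kvanish_nzd (c := fun a => (a == t)%:R)); rewrite ?Et.
- exact: is_ideal_var.
- exact: var_nonzerodivisor.
- by rewrite -var_ideal_adjoin; apply: IHi; rewrite cardsU1 tX; lia.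
Qed.

Lemma graded_max_lin f : @graded_max_ideal K n f -> exists c, f = \sum_a c a * 'X_a.
Proof.
move: f; apply: ideal_gen_min => [|_ [t _ ->]].
  split.
  - by exists (fun=> 0); rewrite big1 // => a _; rewrite mul0r.
  - move=> _ _ [c ->] [d ->]; exists (fun a => c a + d a).
    by rewrite -big_split; apply: eq_bigr => a _; rewrite mulrDl.
  - move=> r _ [c ->]; exists (fun a => r * c a).
    by rewrite mulr_sumr; apply: eq_bigr => a _; rewrite mulrA.
exists (fun a => (a == t)%:R).
rewrite (bigD1 t) //= eqxx mul1r big1 ?addr0 // => a /negPf->.
by rewrite mul0r.
Qed.

Lemma graded_max_not1 : ~ @graded_max_ideal K n 1.
Proof.
by case/var_idealP/(_ 0%MM) => [|i _]; rewrite ?mcoeff1 ?eqxx ?oner_eq0 ?mnm0E.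
Qed.

(** * Depth through Koszul cohomology *)

Lemma regular_seq_kvanish (I : S -> Prop) (fs : seq S) : is_ideal I ->
  (forall f, f \in fs -> graded_max_ideal f) -> regular_seq I fs ->
  forall i, (i <= size fs)%N -> kvanish (fun a => 'X_a : S) I i.
Proof.
move=> iI mfs fs_reg; apply: kvanish_regular fs_reg _ => // f /mfs.
exact: graded_max_lin.
Qed.

(** The maximum in the definition of depth exists: lengths of regular sequences
    are bounded by n. *)
Lemma depthP (I : S -> Prop) : is_ideal I -> (forall f, I f -> graded_max_ideal f) ->
  is_depth I (depth I).
Proof.
move=> iI Im; apply: epsilon_spec.
pose P r := exists fs : seq S,
   [/\ size fs = r, forall f, f \in fs -> graded_max_ideal f & regular_seq I fs].
have P_le_n r : P r -> (r <= n)%N.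
  case=> fs [<- mfs fs_reg]; rewrite leqNgt; apply/negP => lt_n.
  apply: (not_kvanish_top iI (is_ideal_var setT) graded_max_not1 Im _
            (regular_seq_kvanish iI mfs fs_reg lt_n)).
  by move=> a; apply/mem_var_ideal; rewrite inE.
have P0 : P 0%N.
  have m_nil f : f \in [::] -> @graded_max_ideal K n f by [].
  exists [::]; split=> //; split=> // /(add_seq_min (is_ideal_var setT) Im m_nil).
  exact: graded_max_not1.
have [r [Pr rmax]] : exists r, P r /\ forall r', P r' -> (r' <= r)%N.
  apply: NNPP => no_max.
  suff PN r : exists2 r', (r <= r')%N & P r'.
    by have [r' lt_r' /P_le_n] := PN n.+1; lia.
  elim: r => [|r [r' le_r Pr']]; first by exists 0%N.
  apply: NNPP => no_r; apply: no_max; exists r'; split=> // r'' Pr''.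
  by rewrite leqNgt; apply/negP => lt_r; apply: no_r; exists r'' => //; lia.
by exists r; split=> // fs mfs fs_reg; apply: rmax; exists fs.
Qed.

Lemma depth_ge (I : S -> Prop) r : is_ideal I -> (forall f, I f -> graded_max_ideal f) ->
  (forall i, (i <= r)%N -> kvanish (fun a => 'X_a : S) I i) -> (r <= depth I)%N.
Proof.
move=> iI Im van; have [_ dmax] := depthP iI Im.
have [|fs [<- mfs fs_reg]] := regular_seq_of_kvanish (@mpoly_noetherian K n)
   iI (is_ideal_var setT) graded_max_not1 Im _ van; last exact: dmax.
by move=> a; apply/mem_var_ideal; rewrite inE.
Qed.

Lemma depth_lt (I : S -> Prop) r : is_ideal I -> (forall f, I f -> graded_max_ideal f) ->
  ~ kvanish (fun a => 'X_a : S) I r -> (depth I < r)%N.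
Proof.
move=> iI Im nvan; have [[fs [fs_d mfs fs_reg]] _] := depthP iI Im.
rewrite ltnNge -fs_d; apply/negP => le_r; apply: nvan.
exact: regular_seq_kvanish fs_reg _ le_r.
Qed.

End MonomialIdeals.

(** * Squarefree linear quotients *)

Section LinearQuotientSets.

Variables (n d : nat) (Us : seq {set 'I_n}).
Implicit Types (A B D E T V : {set 'I_n}).

Local Notation U i := (nth set0 Us i).

(** The variable t belongs to the colon ideal of the i-th generator by the previous
    ones, when Us lists the supports of squarefree monomials. *)
Definition covered i t : bool := has (fun V => V \subset t |: U i) (take i Us).

(** Linear quotients in combinatorial terms: a squarefree monomial of support T in
    the colon ideal is divisible by a variable of that ideal. *)
Definition linear_quotient_sets : Prop := forall i T, (i < size Us)%N ->
  has (fun V => V \subset T :|: U i) (take i Us) ->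
  exists2 t, t \in T & covered i t.

Hypotheses (Us_uniq : uniq Us) (Us_card : forall V, V \in Us -> #|V| = d).
Hypothesis Us_lq : linear_quotient_sets.

(** If t were in U i, an earlier set of the same size would lie in U i. *)
Lemma covered_notin i t : (i < size Us)%N -> covered i t -> t \notin U i.
Proof.
move=> lt_i /hasP[V V_i VtU]; apply: contraL (V_i) => tU.
have /eqP-> : V == U i.
  rewrite eqEcard (Us_card (mem_nth set0 lt_i)) (Us_card _) ?leqnn ?andbT; last first.
  - by move: V_i; apply: mem_take.
  - by rewrite (subset_trans VtU) // subUset sub1set tU subxx.
by rewrite in_take ?mem_nth // index_uniq // ltnn.
Qed.

Variable K : fieldType.
Implicit Types (g w : {set 'I_n} -> K).

Local Notation coface := (kdiff (fun=> 1 : K)).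

Definition delta_fun A B : K := (B == A)%:R.

Lemma coface_delta A t : t \notin A -> coface (delta_fun A) (t |: A) = ksign K t A.
Proof.
move=> tA; rewrite /kdiff (bigD1 t) ?setU11 //= ksign_self setU1K //.
rewrite /delta_fun eqxx !mulr1 big1 ?addr0 // => a /andP[/setU1P[->|aA] at_].
  by rewrite eqxx in at_.
case: eqP => [EA|]; last by rewrite mulr0.
by have := setD11 a (t |: A); rewrite EA aA.
Qed.

Lemma coface_delta_sub A D : coface (delta_fun A) D != 0 -> A \subset D.
Proof.
apply: contraNT => AD; rewrite /kdiff big1 // => a aD; rewrite /delta_fun.
case: eqP => [EA|_]; last by rewrite mulr0.
by rewrite -EA subD1set in AD.
Qed.

(** Evaluate the cocycle condition at U i with t and t0 added. A term of w removing
    a in U i vanishes: otherwise an earlier set would lie in U i, t, t0, and one of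
    t, t0 would be covered. The two remaining terms compare the values of w at
    U i with t and U i with t0. *)
Lemma coface_extension_const w i t t0 : (i < size Us)%N ->
    (forall D, #|D| = d.+1 -> w D != 0 -> has (fun V => V \subset D) (take i.+1 Us)) ->
    (forall E, #|E| = d.+2 -> coface w E = 0) ->
    t \notin U i -> t0 \notin U i -> ~~ covered i t -> ~~ covered i t0 ->
  w (t |: U i) = ksign K t0 (U i) * w (t0 |: U i) * ksign K t (U i).
Proof.
move=> lt_i w_supp w_cocycle tU t0U nt nt0.
have cardU : #|U i| = d by apply/Us_card/mem_nth.
have [->|tt0] := eqVneq t t0; first by rewrite mulrAC ksign_sqr mul1r.
pose E := t |: (t0 |: U i).
have tE : t \notin t0 |: U i by rewrite !inE (negPf tt0).
have Esym : E = t0 |: (t |: U i) by rewrite /E setUCA.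
have t0E : t0 \notin t |: U i by rewrite !inE eq_sym (negPf tt0).
have cardE : #|E| = d.+2 by rewrite /E !cardsU1 tE t0U cardU.
have := w_cocycle E cardE.
rewrite /kdiff (bigD1 t) ?setU11 //= (bigD1 t0); last by rewrite Esym setU11 eq_sym.
rewrite /= big1 => [|a]; last first.
  case/andP => /andP[aE at_] at0.
  have aU : a \in U i by move: aE; rewrite !inE (negPf at_) (negPf at0).
  have cardD : #|E :\ a| = d.+1 by move: (cardsD1 a E); rewrite aE cardE => -[].
  have [->|/w_supp] := eqVneq (w (E :\ a)) 0; first by rewrite mulr0.
  move=> /(_ cardD); rewrite (take_nth set0 lt_i) has_rcons => /orP[|/hasP[V V_i VE]].
    by move/subsetP/(_ a aU); rewrite setD11.
  have [|s] := Us_lq (T := [set t; t0]) lt_i.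
    apply/hasP; exists V => //; apply: subset_trans VE _.
    by rewrite -setUA subD1set.
  by case/set2P => ->; rewrite ?(negPf nt) ?(negPf nt0).
rewrite {1 2}/E setU1K // ksign_self ksignU1 //.
rewrite Esym setU1K // ksign_self ksignU1 // !mulr1 addr0 (sign_lt_anti K (a := t) (b := t0)) //.
set eps := (-1) ^+ (t0 < t)%N; have eps2 : eps * eps = 1 by rewrite -expr2 sqrr_sign.
move=> E0; have := congr1 (fun x => eps * ksign K t0 (U i) * x) E0.
rewrite mulr0 mulrDr => /eqP; rewrite addr_eq0 => /eqP E1.
rewrite -[LHS]mul1r -{1}eps2 -[eps * eps]mulr1 -{1}(ksign_sqr K t0 (U i)).
transitivity (- (eps * ksign K t0 (U i) * (ksign K t0 (U i) * - eps * w (t |: U i)))).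
  by ring.
rewrite -E1 -[RHS]mul1r -{1}eps2; ring.
Qed.

Lemma subset_card_succ A D : A \subset D -> #|D| = #|A|.+1 ->
  exists2 t, t \notin A & D = t |: A.
Proof.
move=> AD cardD; have /eqP/cards1P[t Dt] : #|D :\: A| = 1%N.
  by rewrite cardsDS // cardD subSnn.
exists t; first by have := set11 t; rewrite -Dt inE => /andP[].
by rewrite -Dt setUC setDE setUIr setUCr setIT; apply/esym/setUidPr.
Qed.

(** Induction along the ordering, as for the homology of a shellable complex (the
    complements of the U i form one). A cocycle w is first corrected by a multiple
    of the coboundary of the indicator function of U i so as to vanish on the
    sets containing U i but no earlier U j; by [coface_extension_const] one
    multiple works for all of them. *)
Lemma linear_quotient_acyclic i w : (i <= size Us)%N ->
    (forall D, #|D| = d.+1 -> w D != 0 -> has (fun V => V \subset D) (take i Us)) ->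
    (forall E, #|E| = d.+2 -> coface w E = 0) ->
  exists g, (forall B, #|B| = d -> g B != 0 -> B \in take i Us) /\
    forall D, #|D| = d.+1 -> w D = coface g D.
Proof.
elim: i w => [|i IHi] w lt_i w_supp w_cocycle.
  exists (fun=> 0); split=> [B _|D cardD]; first by rewrite eqxx.
  rewrite /kdiff big1 => [|a _]; last by rewrite mulr0.
  by apply/eqP; apply: contraT => /w_supp; rewrite take0 => /(_ cardD).
have cardU : #|U i| = d by apply/Us_card/mem_nth.
have takeS := take_nth set0 lt_i.
have [[t0 [t0U nt0]] | all_cov] :=
  classic (exists t0, t0 \notin U i /\ ~~ covered i t0); last first.
  have [||g [g_supp gw]] := IHi w (ltnW lt_i) => //.
    move=> D cardD wD; have := w_supp D cardD wD; rewrite takeS has_rcons => /orP[UD|//].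
    have [|t tU ->] := subset_card_succ UD; first by rewrite cardU.
    by apply: contraT => nt; case: all_cov; exists t.
  by exists g; split=> // B cardB /(g_supp B cardB); rewrite takeS mem_rcons inE orbC => ->.
pose c := ksign K t0 (U i) * w (t0 |: U i).
have [||g [g_supp gw]] := IHi (fun D => w D - c * coface (delta_fun (U i)) D) (ltnW lt_i).
- move=> D cardD; apply: contraNT => nD; rewrite subr_eq0; apply/eqP.
  have [UD|UD] := boolP (U i \subset D).
    have [|t tU Dt] := subset_card_succ UD; first by rewrite cardU.
    rewrite Dt coface_delta // (coface_extension_const (t0 := t0) lt_i w_supp) //.
    by rewrite /covered -Dt.
  have -> : w D = 0.
    apply/eqP; apply: contraT => /(w_supp D cardD).
    by rewrite takeS has_rcons (negPf UD) (negPf nD).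
  have -> : coface (delta_fun (U i)) D = 0.
    by apply/eqP; apply: contraNT UD; apply: coface_delta_sub.
  by rewrite mulr0.
- by move=> E cardE; rewrite kdiffB kdiffZ kdiff_kdiff mulr0 w_cocycle // subrr.
exists (fun B => g B + c * delta_fun (U i) B); split=> [B cardB|D cardD].
  rewrite takeS mem_rcons inE /delta_fun; case: (B =P U i) => //= _.
  by rewrite mulr0 addr0; apply: g_supp.
by rewrite kdiffD kdiffZ -gw // subrK.
Qed.

(** When every t outside U i is covered, the coboundary of the indicator function of
    U i is carried by sets containing an earlier U j; it is then the coboundary of
    a function on the earlier U j, and the difference is the cocycle sought. *)
Lemma full_covered_cocycle i : (i < size Us)%N ->
    (forall t, t \notin U i -> covered i t) ->
  exists g, [/\ forall B, #|B| = d -> g B != 0 -> B \in Us,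
    forall D, #|D| = d.+1 -> coface g D = 0 & g (U i) = 1].
Proof.
move=> lt_i all_cov; have cardU : #|U i| = d by apply/Us_card/mem_nth.
have [|||g [g_supp gU]] := @linear_quotient_acyclic i (coface (delta_fun (U i))).
- exact: ltnW.
- move=> D cardD /coface_delta_sub UD.
  by have [|t tU ->] := subset_card_succ UD; [rewrite cardU | apply: all_cov].
- by move=> E _; apply: kdiff_kdiff.
exists (fun B => delta_fun (U i) B - g B); split.
- move=> B cardB; rewrite /delta_fun; case: (B =P U i) => [->|_]; first by rewrite mem_nth.
  by rewrite sub0r oppr_eq0 => /(g_supp B cardB)/mem_take.
- by move=> D cardD; rewrite kdiffB -gU // subrr.
have -> : g (U i) = 0.
  apply/eqP; apply: contraT => /(g_supp _ cardU).
  by rewrite in_take ?mem_nth // index_uniq // ltnn.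
by rewrite subr0 /delta_fun eqxx.
Qed.

End LinearQuotientSets.

(** * Depth of squarefree ideals with linear quotients *)

Section SquarefreeDepth.

Variables (K : fieldType) (n : nat).
Local Notation S := {mpoly K[n]}.
Implicit Types (A B D V : {set 'I_n}) (m : 'X_{1..n}) (f : S).

Lemma mesym1_le V m : (mesym1 V <= m)%MM = (V \subset msupport m).
Proof.
apply/mnm_lepP/subsetP => Vm i; first by move=> iV; have := Vm i; rewrite inE mnmE iV.
by rewrite mnmE; case: (boolP (i \in V)) => // /Vm; rewrite inE.
Qed.

Lemma msupport_mesym1 V : msupport (mesym1 V) = V.
Proof. by apply/setP => i; rewrite inE mnmE; case: (i \in V). Qed.

Lemma msupportD (m1 m2 : 'X_{1..n}) : msupport (m1 + m2) = msupport m1 :|: msupport m2.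
Proof. by apply/setP => i; rewrite !inE mnmDE addn_gt0. Qed.

Lemma msupport1 (t : 'I_n) : msupport U_(t) = [set t].
Proof. by apply/setP => i; rewrite !inE mnm1E eq_sym; case: eqP. Qed.

Definition sqfree_ideal (Us : seq {set 'I_n}) : S -> Prop :=
  monomial_ideal ([seq mesym1 V | V <- Us]).

Lemma is_ideal_sqfree Us : is_ideal (sqfree_ideal Us).
Proof. exact: is_ideal_gen. Qed.

Lemma colon_sqfreeP Us A f : colon (sqfree_ideal Us) 'X_[mesym1 A] f <->
  (forall m, f@_m != 0 -> has (fun V => V \subset msupport m :|: A) Us).
Proof.
rewrite monomial_colonP; split=> Hf m /Hf.
  case=> _ /mapP[V V_Us ->] le_V; apply/hasP; exists V => //.
  by rewrite setUC -{1}[A]msupport_mesym1 -msupportD -mesym1_le.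
case/hasP=> V V_Us VmA; exists (mesym1 V); first exact: map_f.
by rewrite mesym1_le msupportD msupport_mesym1 setUC.
Qed.

Lemma colon_sqfree_X Us A m : colon (sqfree_ideal Us) 'X_[mesym1 A] ('X_[m] : S) <->
  has (fun V => V \subset msupport m :|: A) Us.
Proof.
rewrite colon_sqfreeP; split=> [/(_ m)|Us_m m']; rewrite mcoeffX ?eqxx.
  by apply; apply: oner_neq0.
by case: (m =P m') => [<- //|_ /=]; rewrite eqxx.
Qed.

Lemma sqfree_ideal_take Us i : (i < size Us)%N ->
  sqfree_ideal (take i.+1 Us) = adjoin (sqfree_ideal (take i Us)) 'X_[mesym1 (nth set0 Us i)].
Proof.
move=> lt_i; apply: ideal_gen_adjoin => f; rewrite (take_nth set0 lt_i) map_rcons; split.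
  by case=> u; rewrite mem_rcons inE => /orP[/eqP->|u_i] ->; [right | left; exists u].
case=> [[u u_i ->]|->]; first by exists u; rewrite // mem_rcons inE u_i orbT.
by exists (mesym1 (nth set0 Us i)); rewrite // mem_rcons mem_head.
Qed.

Variables (d : nat) (Us : seq {set 'I_n}).
Hypotheses (Us_uniq : uniq Us) (Us_card : forall V, V \in Us -> #|V| = d).
Hypothesis d_gt0 : (0 < d)%N.

Local Notation U i := (nth set0 Us i).
Local Notation X := (fun a : 'I_n => 'X_a : S).

Lemma sqfree_ideal_mdeg f m : sqfree_ideal Us f -> f@_m != 0 -> (d <= mdeg m)%N.
Proof.
move=> /monomial_genP If /If[_ /mapP[V /Us_card <- ->] le_V].
by rewrite -(mdeg_mesym1 V) -(submK le_V) mdegD leq_addl.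
Qed.

Lemma sqfree_ideal_sub_max f : sqfree_ideal Us f -> graded_max_ideal f.
Proof.
move=> If; apply/var_idealP => m /(sqfree_ideal_mdeg If) le_d.
apply: NNPP => no_i; have: (0 < mdeg m)%N by apply: leq_trans le_d.
rewrite lt0n mdeg_eq0 => /eqP; apply; apply/mnmP => i; rewrite mnm0E.
by apply/eqP; rewrite -leqn0 leqNgt; apply/negP => m_i; apply: no_i; exists i.
Qed.

Lemma mesym1_setD1 A a : a \in A -> mesym1 A = (U_(a) + mesym1 (A :\ a))%MM.
Proof.
move=> aA; apply/mnmP => i; rewrite mnmDE mnm1E !mnmE !inE [i == a]eq_sym.
by case: eqP => [<-|]; rewrite ?aA.
Qed.

Lemma ksign_mpoly a A : ksign S a A = (ksign K a A)%:MP.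
Proof. by rewrite /ksign rmorph_sign. Qed.

(** Cochains of multidegree 0 form the cochain complex of a simplex over K; the next
    lemma is the projection onto that multidegree. *)
Lemma kdiff_X_mesym1 (q : {set 'I_n} -> K) A :
  kdiff X (fun B => q B *: 'X_[mesym1 B]) A = kdiff (fun=> 1) q A *: 'X_[mesym1 A].
Proof.
rewrite /kdiff scaler_suml; apply: eq_bigr => a aA.
rewrite (mesym1_setD1 aA) mpolyXD ksign_mpoly !mul_mpolyC mulr1.
by rewrite -scalerAl -scalerAr scalerA.
Qed.

Lemma mcoeff_kdiff_X (y : {set 'I_n} -> S) A :
  (kdiff X y A)@_(mesym1 A) = kdiff (fun=> 1) (fun B => (y B)@_(mesym1 B)) A.
Proof.
rewrite raddf_sum; apply: eq_bigr => a aA /=.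
rewrite ksign_mpoly -mulrA mcoeffCM mulr1; congr (_ * _).
by rewrite (mesym1_setD1 aA) mulrC mcoeffMX.
Qed.

(** The simplex being acyclic, g is the coboundary of a cochain q on (d-1)-sets.
    Taken in multidegree 0, q is a cocycle modulo the ideal, as g is carried by
    generators; were it a coboundary modulo the ideal, which contains no monomial
    of degree d - 1, then q would be a coboundary over K, and g = 0. *)
Lemma not_kvanish_of_cocycle (g : {set 'I_n} -> K) A0 :
    #|A0| = d -> g A0 != 0 ->
    (forall B, #|B| = d -> g B != 0 -> B \in Us) ->
    (forall D, #|D| = d.+1 -> kdiff (fun=> 1) g D = 0) ->
  ~ kvanish X (sqfree_ideal Us) d.
Proof.
move=> A0d gA0 g_supp g_cocycle van.
have /card_gt0P[a0 _] : (0 < #|A0|)%N by rewrite A0d.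
pose q := kcontr (fun a => (a == a0)%:R) g.
have dq B : #|B| = d -> kdiff (fun=> 1) q B = g B.
  move=> Bd; have := kdiff_contr (fun=> 1) (fun a => (a == a0)%:R) g B.
  rewrite (bigD1 a0) //= eqxx mulr1 big1 ?addr0 ?mul1r => [<-|a /negPf->]; last by rewrite mul0r.
  rewrite [X in _ + X]big1 ?addr0 // => b bB.
  by rewrite g_cocycle ?mulr0 // cardsU1 bB Bd.
have [B Bd|y Hy] := van (fun B => q B *: 'X_[mesym1 B]).
  rewrite kdiff_X_mesym1 dq //; have [->|/(g_supp B Bd) B_Us] := eqVneq (g B) 0.
    by rewrite scale0r; apply: ideal0 (is_ideal_sqfree _).
  rewrite -mul_mpolyC; apply: idealMl; first exact: is_ideal_sqfree.
  by apply: mem_ideal_gen; exists (mesym1 B); rewrite ?map_f.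
case/eqP: gA0; rewrite -dq // -(kdiff_kdiff (fun=> 1) (fun B => (y B)@_(mesym1 B)) A0).
apply: eq_kdiff => A; rewrite A0d => Ad; rewrite -mcoeff_kdiff_X; apply/eqP.
rewrite -subr_eq0; apply: contraT => nz.
have := @sqfree_ideal_mdeg _ (mesym1 A) (Hy A Ad).
rewrite mcoeffB mcoeffZ mcoeffX eqxx mulr1 => /(_ nz).
by rewrite mdeg_mesym1 -Ad ltnn.
Qed.

Hypothesis Us_lq : forall i, (0 < i < size Us)%N -> exists Y : {set 'I_n}, forall f,
  colon (sqfree_ideal (take i Us)) 'X_[mesym1 (U i)] f <-> var_ideal Y f.

Lemma colon_covered i : (i < size Us)%N ->
  colon (sqfree_ideal (take i Us)) 'X_[mesym1 (U i)] =
  var_ideal [set t | covered Us i t].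
Proof.
move=> lt_i.
have [Y /pred_ext EY] : exists Y : {set 'I_n}, forall f,
    colon (sqfree_ideal (take i Us)) 'X_[mesym1 (U i)] f <-> var_ideal Y f.
  case: i lt_i => [_|i lt_i]; last exact: Us_lq.
  exists set0 => f; rewrite colon_sqfreeP var_idealP take0.
  by split=> H m /H //; case=> j; rewrite inE.
rewrite EY; congr var_ideal; apply/setP => t; rewrite inE.
apply/idP/idP; first move=> /(mem_var_ideal K).
  by rewrite -EY colon_sqfree_X msupport1.
move=> cov_t; apply/(mem_var_ideal K); rewrite -EY.
by apply/colon_sqfree_X; rewrite msupport1.
Qed.

Lemma linear_quotient_sets_of_colon : linear_quotient_sets Us.
Proof.
move=> i T lt_i hasT.
have : colon (sqfree_ideal (take i Us)) 'X_[mesym1 (U i)] ('X_[mesym1 T] : S).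
  by apply/colon_sqfree_X; rewrite msupport_mesym1.
rewrite colon_covered // => /var_idealP/(_ (mesym1 T)).
rewrite mcoeffX eqxx oner_eq0 => /(_ isT)[t]; rewrite inE mnmE => cov_t tT.
by exists t => //; move: tT; case: (t \in T).
Qed.

(** S/J for J the colon ideal at step i is a polynomial ring in n - #|X_i| variables,
    X_i being the set of covered variables, so it has no cohomology in degree e. *)
Lemma kvanish_sqfree e : (e <= n)%N ->
    (forall i, (i < size Us)%N -> (#|[set t | covered Us i t]| + e < n)%N) ->
  kvanish X (sqfree_ideal Us) e.
Proof.
move=> le_en He; rewrite -[Us]take_size.
have : (size Us <= size Us)%N by [].
elim: {1 3}(size Us) => [_|i IHi lt_i].
  rewrite take0 (_ : sqfree_ideal [::] = var_ideal set0).
    by apply: kvanish_var_ideal; rewrite cards0 subn0.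
  apply: pred_ext => f; rewrite /sqfree_ideal /monomial_ideal monomial_genP var_idealP.
  by split=> H m /H[x]; rewrite ?inE.
rewrite sqfree_ideal_take //; apply: kvanish_adjoin.
- exact: is_ideal_sqfree.
- by rewrite colon_covered //; apply: kvanish_var_ideal; have := He i lt_i; lia.
- exact/IHi/ltnW.
Qed.

Lemma covered_sub i : (i < size Us)%N -> [set t | covered Us i t] \subset ~: U i.
Proof.
by move=> lt_i; apply/subsetP => t; rewrite !inE; apply: covered_notin Us_uniq Us_card _ _ lt_i.
Qed.

(** The covered variables at step i are among the n - d variables outside U i. *)
Lemma depth_sqfree_ge : (0 < size Us)%N -> (d.-1 <= depth (sqfree_ideal Us))%N.
Proof.
move=> Us_gt0; have d_le_n : (d <= n)%N.
  by rewrite -(Us_card (mem_nth set0 Us_gt0)) -[n in (_ <= n)%N]card_ord max_card.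
apply: depth_ge (is_ideal_sqfree _) sqfree_ideal_sub_max _ => e le_e.
apply: kvanish_sqfree => [|i lt_i]; first by lia.
have := subset_leq_card (covered_sub lt_i); have := cardsC (U i).
by rewrite (Us_card (mem_nth _ lt_i)) card_ord; lia.
Qed.

(** With at least two generators, n > d, which is what allows regular sequences of
    length d when no step covers all variables outside its support. *)
Lemma depth_sqfree_min : (1 < size Us)%N ->
  depth (sqfree_ideal Us) = d.-1 <->
  exists i, (i < size Us)%N /\ forall t, t \notin U i -> covered Us i t.
Proof.
move=> Us_gt1; have Us_gt0 := ltnW Us_gt1; split=> [depth_d|[i [lt_i all_cov]]].
  apply: NNPP => no_i; suff: (d <= d.-1)%N by lia.
  rewrite -depth_d; apply: depth_ge (is_ideal_sqfree _) sqfree_ideal_sub_max _ => e le_e.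
  have lt_dn : (d < n)%N.
    have U01 : U 0 != U 1 by rewrite nth_uniq.
    have : U 0 :|: U 1 != U 0.
      apply: contraNneq U01 => /setUidPl U10.
      by rewrite eq_sym eqEcard U10 !Us_card ?mem_nth ?leqnn.
    rewrite eq_sym eqEcard subsetUl /= -ltnNge (Us_card (mem_nth _ Us_gt0)).
    by move/leq_trans; apply; rewrite -[n in (_ <= n)%N]card_ord max_card.
  apply: kvanish_sqfree => [|i lt_i]; first by lia.
  have [t tU nt] : exists2 t, t \notin U i & ~~ covered Us i t.
    apply: NNPP => no_t; apply: no_i; exists i; split=> // t tU.
    by apply: contraT => nt; case: no_t; exists t.
  have : [set t | covered Us i t] \proper ~: U i.
    rewrite properE covered_sub //; apply/subsetPn; exists t; rewrite !inE //.
  move/proper_card; have := cardsC (U i).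
  by rewrite (Us_card (mem_nth _ lt_i)) card_ord; lia.
have [g [g_supp g_cocycle gU]] :=
  full_covered_cocycle Us_uniq Us_card linear_quotient_sets_of_colon K lt_i all_cov.
have : (depth (sqfree_ideal Us) < d)%N.
  apply: depth_lt (is_ideal_sqfree _) sqfree_ideal_sub_max _.
  apply: (not_kvanish_of_cocycle (A0 := U i)) g_supp g_cocycle; first exact/Us_card/mem_nth.
  by rewrite gU oner_eq0.
by have := depth_sqfree_ge Us_gt0; lia.
Qed.

End SquarefreeDepth.

(** * Squarefree powers of edge ideals *)

Section SquarefreePowers.

Variables (K : fieldType) (n : nat).
Local Notation S := {mpoly K[n]}.

(** Otherwise u could be dropped, being a multiple of v. *)
Lemma minimal_generators_antichain (I : S -> Prop) us u v :
  minimal_generators I us -> u \in us -> v \in us -> (v <= u)%MM -> v = u.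
Proof.
move=> [us_uniq Ius us_min] u_us v_us le_vu; apply/eqP; apply: contraT => vu.
have := us_min [seq w <- us | w != u] (mem_subseq (filter_subseq _ _)).
move=> /(_ _)/(_ _ u_us); rewrite mem_filter eqxx /=; apply=> f; rewrite Ius.
rewrite /monomial_ideal !monomial_genP; split=> H m /H[w w_us le_w].
  have [wu|wu] := eqVneq w u; last by exists w; rewrite // mem_filter wu.
  by exists v; [rewrite mem_filter vu | rewrite -wu in le_vu; apply: lepm_trans le_w].
by exists w => //; move: w_us; rewrite mem_filter => /andP[].
Qed.

Variables (G : sgraph n) (k : nat).

Lemma edge_neighbour (e : {set 'I_n}) v : e \in edges G -> v \in e ->
  exists2 w, w \in e & adj G v w.
Proof.
case/imsetP=> -[x y]; rewrite inE /= => xy -> /set2P[->|->].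
  by exists y; rewrite ?set22.
by exists x; rewrite ?set21 // adj_sym.
Qed.

Lemma card_edge (e : {set 'I_n}) : e \in edges G -> #|e| = 2%N.
Proof.
case/imsetP=> -[x y]; rewrite inE /= => xy ->; rewrite cards2.
by case: eqP xy => // ->; rewrite adj_irrefl.
Qed.

Lemma card_cover_kmatching M : kmatching G k M -> #|cover M| = (2 * k)%N.
Proof.
move=> /andP[/andP[/subsetP M_edges /eqP<-] /eqP<-].
rewrite (eq_bigr (fun=> 2%N)) => [|e /M_edges/card_edge//].
by rewrite sum_nat_const mulnC.
Qed.

Lemma kmatching_monomial M : kmatching G k M ->
  \prod_(e in M) \prod_(x in e) 'X_x = 'X_[mesym1 (cover M)] :> S.
Proof.
move=> /andP[/andP[_ trivM] _]; rewrite -big_trivIset // mprodXE; congr 'X_[_].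
apply/mnmP => i; rewrite mnm_sumE mnmE; case: (boolP (i \in cover M)) => iM.
  rewrite (bigD1 i) //= mnm1E eqxx big1 // => j /andP[_ ji].
  by rewrite mnm1E (negPf ji).
by rewrite big1 // => j jM; rewrite mnm1E; case: eqP => // ji; rewrite -ji jM in iM.
Qed.

Lemma sqfree_powerE : @sqfree_power K n G k = ideal_gen (fun f =>
  exists2 u, (exists2 M, kmatching G k M & u = mesym1 (cover M)) & f = 'X_[u]).
Proof.
congr ideal_gen; apply: pred_ext => f; split.
  case=> M kM ->; exists (mesym1 (cover M)); first by exists M.
  exact: kmatching_monomial.
by case=> _ [M kM ->] ->; exists M; rewrite // kmatching_monomial.
Qed.

(** u is a multiple of a matching monomial, itself a multiple of some generator,
    which must be u. *)
Lemma sqfree_power_generator us u :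
  minimal_generators (@sqfree_power K n G k) us -> u \in us ->
  exists2 M, kmatching G k M & u = mesym1 (cover M).
Proof.
move=> us_min u_us; have [_ Ius _] := us_min.
have : sqfree_power G k ('X_[u] : S).
  by apply/Ius; apply: mem_ideal_gen; exists u.
rewrite sqfree_powerE monomial_genP => /(_ u).
rewrite mcoeffX eqxx oner_eq0 => /(_ isT)[_ [M kM ->] le_Mu].
exists M => //.
have : sqfree_power G k ('X_[mesym1 (cover M)] : S).
  by apply: mem_ideal_gen; exists M; rewrite // kmatching_monomial.
rewrite Ius /monomial_ideal monomial_genP => /(_ (mesym1 (cover M))).
rewrite mcoeffX eqxx oner_eq0 => /(_ isT)[v v_us le_vM].
have le_vu := lepm_trans le_vM le_Mu.
have vu := minimal_generators_antichain us_min u_us v_us le_vu.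
rewrite vu in le_vM; apply/mnmP => i; apply/eqP.
by rewrite eqn_leq; apply/andP; split; apply/mnm_lepP: i.
Qed.

Variable us : seq 'X_{1..n}.
Hypothesis us_lq : linear_quotients (@sqfree_power K n G k) us.

Local Notation Us := [seq msupport u | u <- us].

Lemma generator_supportK : us = [seq mesym1 V | V <- Us].
Proof.
rewrite -map_comp -[LHS]map_id; apply/eq_in_map => u u_us /=.
by have [M _ ->] := sqfree_power_generator us_lq.1 u_us; rewrite msupport_mesym1.
Qed.

Lemma generator_support_uniq : uniq Us.
Proof.
by have [[us_uniq _ _] _] := us_lq; move: us_uniq; rewrite {1}generator_supportK => /map_uniq.
Qed.

Lemma generator_supportP V : V \in Us -> exists2 M, kmatching G k M & V = cover M.
Proof.
case/mapP=> u u_us ->; have [M kM ->] := sqfree_power_generator us_lq.1 u_us.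
by exists M; rewrite ?msupport_mesym1.
Qed.

Lemma card_generator_support V : V \in Us -> #|V| = (2 * k)%N.
Proof. by case/generator_supportP=> M /card_cover_kmatching cM ->. Qed.

Lemma sqfree_power_sqfree_ideal : @sqfree_power K n G k = @sqfree_ideal K n Us.
Proof.
apply: pred_ext => f; have [[_ -> _] _] := us_lq.
by rewrite /sqfree_ideal -generator_supportK.
Qed.

Lemma nth_generator_support i : (i < size us)%N ->
  nth set0 Us i = msupport (nth mnm0 us i).
Proof. exact: nth_map. Qed.

Lemma generator_support_linear_quotients i : (0 < i < size Us)%N ->
  exists Y : {set 'I_n}, forall f : S,
    colon (@sqfree_ideal K n (take i Us)) 'X_[mesym1 (nth set0 Us i)] f <->
    var_ideal Y f.
Proof.
rewrite size_map => lt_i; have [_ /(_ i lt_i)[Y HY]] := us_lq; exists Y => f.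
rewrite -HY /sqfree_ideal map_take -generator_supportK.
rewrite -(nth_map _ mnm0) ?size_map; last by case/andP: lt_i.
by rewrite -generator_supportK.
Qed.

(** A matching M with V(M) = U i, i covering all vertices outside U i, is dominating:
    the matching M' that covers v has an edge at v, whose other end is in V(M). It
    cannot avoid v, since V(M') <> V(M) are of the same size. Also i > 0, for at
    i = 0 nothing is covered while U 0 is not everything. *)
Lemma dominating_condition_covered : (1 < size us)%N ->
  dominating_condition G k us <->
  exists i, (i < size Us)%N /\ forall t, t \notin nth set0 Us i -> covered Us i t.
Proof.
move=> us_gt1; have card_Us := card_generator_support.
split=> [[M [i [_ /andP[_ lt_i] covM dom]]] | [i [lt_i all_cov]]].
  exists i; rewrite size_map; split=> // t; rewrite nth_generator_support // -covM.
  case/dom=> M' [j [_ lt_ji covM' sub_t]].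
  have lt_j := ltn_trans lt_ji lt_i.
  apply/hasP; exists (cover M'); last by rewrite nth_generator_support // -covM.
  rewrite covM' -nth_generator_support // -(nth_take _ lt_ji) mem_nth //.
  by rewrite size_take size_map lt_i.
have [M kM covM] := generator_supportP (mem_nth set0 lt_i).
have i_gt0 : (0 < i)%N.
  case: i {lt_i kM covM} all_cov => // all_cov.
  have : nth set0 Us 0 != nth set0 Us 1.
    by rewrite nth_uniq ?generator_support_uniq // size_map // ltnW.
  rewrite eq_sym eqEcard !card_Us ?mem_nth ?size_map ?leqnn ?andbT //; last exact: ltnW.
  by case/subsetPn=> t _ /all_cov; rewrite /covered take0.
have covers t : t \notin cover M -> exists (M' : {set {set 'I_n}}) (j : nat),
    [/\ kmatching G k M', (j < i)%N, cover M' = nth set0 Us j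
      & cover M' \subset t |: cover M].
  rewrite -covM => /all_cov/hasP[V V_i VtU].
  have [M' kM' covM'] := generator_supportP (mem_take V_i).
  have [j lt_j Vj] := nthP set0 V_i.
  rewrite size_take lt_i in lt_j.
  by exists M', j; rewrite -covM'; split=> //; rewrite -Vj nth_take.
rewrite size_map in lt_i.
exists M, i; split.
- split=> // v vM; have [M' [j [kM' lt_ji covM' sub_v]]] := covers v vM.
  have vM' : v \in cover M'.
    apply: contraT => vM'.
    have M'M : cover M' \subset cover M.
      apply/subsetP => x xM'; have := subsetP sub_v x xM'; rewrite !inE.
      by case: eqP => // xv; rewrite -xv xM' in vM'.
    have /eqP : cover M' == cover M.
      by rewrite eqEcard M'M !card_cover_kmatching ?leqnn.
    rewrite covM' -covM => /eqP.
    rewrite nth_uniq ?generator_support_uniq ?size_map // ?(ltn_trans lt_ji) //.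
    by rewrite ltn_eqF.
  have /bigcupP[e eM' ve] := vM'.
  have e_edge : e \in edges G by case/andP: kM' => /andP[/subsetP/(_ e eM')].
  have [w we vw] := edge_neighbour e_edge ve; exists w => //.
  have wM' : w \in cover M' by apply/bigcupP; exists e.
  have := subsetP sub_v w wM'; rewrite !inE => /orP[/eqP wv|//].
  by rewrite wv adj_irrefl in vw.
- by rewrite i_gt0.
- by rewrite -nth_generator_support // covM.
- move=> t /covers[M' [j [kM' lt_ji covM' sub_t]]]; exists M', j; split=> //.
  by rewrite -nth_generator_support // (ltn_trans lt_ji).
Qed.

End SquarefreePowers.

(* [1 < size us] : the range i = 2, ..., s of (ii) is nonempty. If s = 1 then
   n = 2k, so (i) holds while (ii) fails; e.g. G = K_2, k = 1, where
   depth K[x_1, x_2]/(x_1 x_2) = 1. *)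
Theorem proposition3p3 (K : fieldType) (n : nat) (G : sgraph n) (k : nat)
    (hiso : no_isolated G) (hk : (1 <= k <= matching_number G)%N) :
  (forall us : seq 'X_{1..n},
     linear_quotients (@sqfree_power K n G k) us ->
     (1 < size us)%N ->
     (normalized_depth K G k = 0%R <-> dominating_condition G k us)) /\
  (cochordal G ->
   forall us : seq 'X_{1..n},
     linear_quotients (@sqfree_power K n G k) us ->
     (1 < size us)%N ->
     (normalized_depth K G k = 0%R <-> dominating_condition G k us)).


Proof.
suff main us : linear_quotients (@sqfree_power K n G k) us -> (1 < size us)%N ->
    normalized_depth K G k = 0%R <-> dominating_condition G k us.
  by split=> [|_] us; apply: main.
move=> us_lq us_gt1; have k_gt0 : (0 < k)%N by case/andP: hk.
rewrite (dominating_condition_covered us_lq us_gt1).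
rewrite -(depth_sqfree_min (K := K) (generator_support_uniq us_lq) (card_generator_support us_lq)).
- rewrite /normalized_depth (sqfree_power_sqfree_ideal us_lq); lia.
- by lia.
- exact: (generator_support_linear_quotients us_lq).
- by rewrite size_map.
Qed.
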